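(* Let $\mathbf A=(A,\le,0,1)$ be a bounded MLUB-complete poset, $T$ a nonempty set, and $P,F,H,G:\mathcal P_+(A^T)\to(\mathcal P_+A)^T$ arbitrary maps (tense operators on $\mathbf A$). Let $R^*$ be the relation induced by $P,F,H,G$ and suppose $R^*$ is serial. Let $P^*,F^*,H^*,G^*$ be the tense operators on $\mathbf A$ induced by the time frame $(T,R^* )$. Then for every $B\in\mathcal P_+(A^T)$: $P^*(B)\le_2 P(B)$, $F^*(B)\le_2F(B)$, $H(B)\le_1H^*(B)$ and $G(B)\le_1 G^*(B)$.
   Context: For a poset and $X\subseteq A$: $L(X)$, $U(X)$ are the sets of lower/upper bounds of $X$; $\operatorname{Max}X,\operatorname{Min}X$ the sets of maximal/minimal elements. MLUB-complete: for every nonempty $M\subseteq A$, every upper bound of $M$ lies above some minimal upper bound of $M$, and every lower bound lies below some maximal lower bound. $\mathcal P_+(X)$ = nonempty subsets of $X$. For subsets $X,Y$: $X\le Y$ iff $x\le y$ for all $x\in X,y\in Y$; $X\le_1Y$ iff every $x\in X$ is below some $y\in Y$; $X\le_2Y$ iff every $y\in Y$ is above some $x\in X$. For $B\subseteq A^T$, $B(t)=\{q(t)\mid q\in B\}$. Elements $Z\in(\mathcal P_+A)^T$ are compared pointwise: $Z\le_i Z'$ means $Z(s)\le_i Z'(s)$ for all $s\in T$ (equivalently, comparison of $\prod_tZ(t)$ and $\prod_tZ'(t)$ in the componentwise order of $A^T$). The relation induced by $P,F,H,G$ is $R^*=\{(s,t)\in T^2\mid H(B)(t)\le B(s)\le P(B)(t)\text{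 and }G(B)(s)\le B(t)\le F(B)(s)\text{ for all }B\in\mathcal P_+(A^T)\}$. A relation $R$ on $T$ is serial if for each $s$ there are $r,t$ with $rRs$, $sRt$. For a time frame $(T,R)$ with $R$ serial, the induced tense operators are given for $B\in\mathcal P_+(A^T)$, $s\in T$ by $P(B)(s)=\operatorname{Min}U(\{q(t)\mid q\in B, tRs\})$, $F(B)(s)=\operatorname{Min}U(\{q(t)\mid q\in B, sRt\})$, $H(B)(s)=\operatorname{Max}L(\{q(t)\mid q\in B, tRs\})$, $G(B)(s)=\operatorname{Max}L(\{q(t)\mid q\in B, sRt\})$. *)

(* Defs.v *)
From mathcomp Require Import all_boot all_order.
From mathcomp Require Import boolp classical_sets.

Set Implicit Arguments.
Unset Strict Implicit.
Unset Printing Implicit Defensive.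

Import Order.TTheory.
Local Open Scope classical_set_scope.
Local Open Scope order_scope.

Record neset (X : Type) := NESet {
  neset_set :> set X;
  neset_nonempty : neset_set !=set0 }.

Definition Max (d : Order.disp_t) (A : porderType d) (X : set A) : set A :=
  [set x | X x /\ forall y, X y -> x <= y -> y = x].

Definition Min (d : Order.disp_t) (A : porderType d) (X : set A) : set A :=
  [set x | X x /\ forall y, X y -> y <= x -> y = x].

Definition MLUB_complete (d : Order.disp_t) (A : porderType d) : Prop :=
  forall M : set A, M !=set0 ->
    (forall u, ubound M u -> exists2 m, Min (ubound M) m & m <= u) /\
    (forall l, lbound M l -> exists2 m, Max (lbound M) m & l <= m).

Definition le_set (d : Order.disp_t) (A : porderType d) (X Y : set A) : Prop :=
  forall x y, X x -> Y y -> x <= y.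

Definition le1_set (d : Order.disp_t) (A : porderType d) (X Y : set A) : Prop :=
  forall x, X x -> exists2 y, Y y & x <= y.

Definition le2_set (d : Order.disp_t) (A : porderType d) (X Y : set A) : Prop :=
  forall y, Y y -> exists2 x, X x & x <= y.

Definition le1 (d : Order.disp_t) (A : porderType d) (T : Type)
    (Z Z' : T -> neset A) : Prop :=
  forall s, le1_set (Z s) (Z' s).

Definition le2 (d : Order.disp_t) (A : porderType d) (T : Type)
    (Z Z' : T -> neset A) : Prop :=
  forall s, le2_set (Z s) (Z' s).

Definition tense_op (A T : Type) : Type := neset (T -> A) -> T -> neset A.

Definition at_time (A T : Type) (B : set (T -> A)) (t : T) : set A :=
  [set q t | q in B].

Definition serial (T : Type) (R : T -> T -> Prop) : Prop :=
  forall s, exists r t, R r s /\ R s t.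

Definition induced_rel (d : Order.disp_t) (A : porderType d) (T : Type)
    (P F H G : tense_op A T) (s t : T) : Prop :=
  forall B : neset (T -> A),
    (le_set (H B t) (at_time B s) /\ le_set (at_time B s) (P B t)) /\
    (le_set (G B s) (at_time B t) /\ le_set (at_time B t) (F B s)).

Definition past_values (A T : Type) (R : T -> T -> Prop)
    (B : set (T -> A)) (s : T) : set A :=
  [set q t | q in B & t in [set t | R t s]].

Definition future_values (A T : Type) (R : T -> T -> Prop)
    (B : set (T -> A)) (s : T) : set A :=
  [set q t | q in B & t in [set t | R s t]].

Lemma past_values_nonempty (A T : Type) (R : T -> T -> Prop)
    (B : neset (T -> A)) (s : T) :
  serial R -> past_values R B s !=set0.
Proof.
move=> /(_ s)[r [_ [Rrs _]]]; have [q Bq] := neset_nonempty B.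
by exists (q r); exists q => //; exists r.
Qed.

Lemma future_values_nonempty (A T : Type) (R : T -> T -> Prop)
    (B : neset (T -> A)) (s : T) :
  serial R -> future_values R B s !=set0.
Proof.
move=> /(_ s)[_ [t [_ Rst]]]; have [q Bq] := neset_nonempty B.
by exists (q t); exists q => //; exists t.
Qed.

Lemma Min_ubound_nonempty (d : Order.disp_t) (A : tbPOrderType d) (M : set A) :
  MLUB_complete A -> M !=set0 -> Min (ubound M) !=set0.
Proof.
move=> hA /hA[/(_ \top) h _]; have [x _|m mM _] := h; last by exists m.
exact: lex1.
Qed.

Lemma Max_lbound_nonempty (d : Order.disp_t) (A : tbPOrderType d) (M : set A) :
  MLUB_complete A -> M !=set0 -> Max (lbound M) !=set0.
Proof.
move=> hA /hA[_ /(_ \bot) h]; have [x _|m mM _] := h; last by exists m.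
exact: le0x.
Qed.

(* Boundedness, MLUB-completeness of A and seriality of R are what makes the
   sets of minimal upper (maximal lower) bounds below nonempty, so that the
   operators induced by (T, R) take their values in neset A. *)
Definition induced_P (d : Order.disp_t) (A : tbPOrderType d) (T : Type)
    (hA : MLUB_complete A) (R : T -> T -> Prop) (hR : serial R) :
    tense_op A T :=
  fun B s => NESet (Min_ubound_nonempty hA (past_values_nonempty B s hR)).

Definition induced_F (d : Order.disp_t) (A : tbPOrderType d) (T : Type)
    (hA : MLUB_complete A) (R : T -> T -> Prop) (hR : serial R) :
    tense_op A T :=
  fun B s => NESet (Min_ubound_nonempty hA (future_values_nonempty B s hR)).

Definition induced_H (d : Order.disp_t) (A : tbPOrderType d) (T : Type)
    (hA : MLUB_complete A) (R : T -> T -> Prop) (hR : serial R) :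
    tense_op A T :=
  fun B s => NESet (Max_lbound_nonempty hA (past_values_nonempty B s hR)).

Definition induced_G (d : Order.disp_t) (A : tbPOrderType d) (T : Type)
    (hA : MLUB_complete A) (R : T -> T -> Prop) (hR : serial R) :
    tense_op A T :=
  fun B s => NESet (Max_lbound_nonempty hA (future_values_nonempty B s hR)).

Lemma induced_opsE (d : Order.disp_t) (A : tbPOrderType d) (T : Type)
    (hA : MLUB_complete A) (R : T -> T -> Prop) (hR : serial R)
    (B : neset (T -> A)) (s : T) :
  [/\ induced_P hA hR B s = Min (ubound (past_values R B s)) :> set A,
      induced_F hA hR B s = Min (ubound (future_values R B s)) :> set A,
      induced_H hA hR B s = Max (lbound (past_values R B s)) :> set A &
      induced_G hA hR B s = Max (lbound (future_values R B s)) :> set A].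
Proof. by []. Qed.

(* Main.v *)
Require Import Defs.
From mathcomp Require Import all_boot all_order.
From mathcomp Require Import boolp classical_sets.

(** The relation [induced_rel] makes each element of [P B s] an upper bound of all past values of
    [B] at [s]; MLUB-completeness then puts a minimal upper bound, an element of [induced_P], below
    it. [F] uses future values, and [H] and [G] are order-dual. *)

Theorem theorem5p2 (d : Order.disp_t) (A : tbPOrderType d)
    (hA : MLUB_complete A) (T : Type) (hT : inhabited T)
    (P F H G : tense_op A T) (hR : serial (induced_rel P F H G))
    (B : neset (T -> A)) :
  [/\ le2 (induced_P hA hR B) (P B),
      le2 (induced_F hA hR B) (F B),
      le1 (H B) (induced_H hA hR B) &
      le1 (G B) (induced_G hA hR B)].
Proof.
split=> s y By.
(* Up to conversion the goal is the conclusion of [hA], so it remains to show that [y] bounds the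
   past values. *)
- apply: (hA _ (past_values_nonempty B s hR)).1 => _ [q Bq [t Rts <-]].
  by apply: (Rts B).1.2 => //; exists q.
- apply: (hA _ (future_values_nonempty B s hR)).1 => _ [q Bq [t Rst <-]].
  by apply: (Rst B).2.2 => //; exists q.
- apply: (hA _ (past_values_nonempty B s hR)).2 => _ [q Bq [t Rts <-]].
  by apply: (Rts B).1.1 => //; exists q.
- apply: (hA _ (future_values_nonempty B s hR)).2 => _ [q Bq [t Rst <-]].
  by apply: (Rst B).2.1 => //; exists q.
Qed.
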